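(* Let $n\ge2$, let $A=(a_{ij})\in M_n(\mathbb{H})$ with $a_{ii}\in\mathbb{R}$ for all $1\le i\le n$, and let $\gamma\in[0,1]$. Then all the right eigenvalues of $A$ are located in the union of the $\frac{n(n-1)}{2}$ ovals of Cassini $$\mathcal{G}_{ij}(A):=\{z\in\mathbb{H}: |z-a_{ii}|\,|z-a_{jj}|\le r_i(A)^{\gamma}\,r_j(A)^{\gamma}\,c_i(A)^{1-\gamma}\,c_j(A)^{1-\gamma}\},\qquad 1\le i,j\le n,\ i\ne j;$$ that is, $\Lambda_r(A)\subseteq \mathcal{G}(A):=\bigcup_{i,j=1,\,i\neq j}^n \mathcal{G}_{ij}(A)$.
   Context: $\mathbb{H}$ is the skew field of real quaternions with its usual modulus $|\cdot|$, and $M_n(\mathbb{H})$ is the set of $n\times n$ quaternionic matrices. A quaternion $\lambda$ is a right eigenvalue of $A$ if $Ax=x\lambda$ for some nonzero column vector $x\in\mathbb{H}^n$; $\Lambda_r(A)$ is the set of right eigenvalues. $r_i(A):=\sum_{j\ne i}|a_{ij}|$ and $c_i(A):=\sum_{j\neq i}|a_{ji}|$. Convention: $0^0=1$. *)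

(* Defs.v *)
From HB Require Import structures.
From mathcomp Require Import all_boot all_order all_algebra ring lra.
From mathcomp Require Import all_classical all_reals all_analysis.

Set Implicit Arguments.
Unset Strict Implicit.
Unset Printing Implicit Defensive.

Import Order.TTheory GRing.Theory Num.Theory.

Local Open Scope classical_set_scope.
Local Open Scope ring_scope.

(* [Quat a b c d] is a + b i + c j + d k. *)
Record quat (R : Type) : Type :=
  Quat { quat0 : R; quat1 : R; quat2 : R; quat3 : R }.

Definition quat_to_prod (R : Type) (x : quat R) : R * R * R * R :=
  (quat0 x, quat1 x, quat2 x, quat3 x).

Definition quat_of_prod (R : Type) (p : R * R * R * R) : quat R :=
  let: (a, b, c, d) := p in Quat a b c d.

Lemma quat_to_prodK (R : Type) : cancel (@quat_to_prod R) (@quat_of_prod R).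
Proof. by case. Qed.

HB.instance Definition _ (R : realType) :=
  Choice.copy (quat R) (can_type (@quat_to_prodK R)).

Lemma quat_eq (R : Type) (x y : quat R) :
  quat0 x = quat0 y -> quat1 x = quat1 y ->
  quat2 x = quat2 y -> quat3 x = quat3 y -> x = y.
Proof. by case: x y => [? ? ? ?] [? ? ? ?] /= -> -> -> ->. Qed.

Definition quat_real (R : realType) (a : R) : quat R := Quat a 0 0 0.

Definition quat_add (R : realType) (x y : quat R) : quat R :=
  Quat (quat0 x + quat0 y) (quat1 x + quat1 y)
       (quat2 x + quat2 y) (quat3 x + quat3 y).

Definition quat_opp (R : realType) (x : quat R) : quat R :=
  Quat (- quat0 x) (- quat1 x) (- quat2 x) (- quat3 x).

Lemma quat_addA (R : realType) : associative (@quat_add R).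
Proof. by move=> x y z; rewrite /quat_add /= !addrA. Qed.

Lemma quat_addC (R : realType) : commutative (@quat_add R).
Proof. by move=> x y; apply: quat_eq; rewrite /= addrC. Qed.

Lemma quat_add0 (R : realType) : left_id (quat_real 0) (@quat_add R).
Proof. by move=> x; apply: quat_eq; rewrite /= add0r. Qed.

Lemma quat_addN (R : realType) :
  left_inverse (quat_real 0) (@quat_opp R) (@quat_add R).
Proof. by move=> x; apply: quat_eq; rewrite /= addNr. Qed.

HB.instance Definition _ (R : realType) :=
  GRing.isZmodule.Build (quat R)
    (@quat_addA R) (@quat_addC R) (@quat_add0 R) (@quat_addN R).

Definition quat_mul (R : realType) (x y : quat R) : quat R :=
  let: Quat a b c d := x in let: Quat a' b' c' d' := y in
  Quat (a * a' - b * b' - c * c' - d * d')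
       (a * b' + b * a' + c * d' - d * c')
       (a * c' - b * d' + c * a' + d * b')
       (a * d' + b * c' - c * b' + d * a').

Lemma quat_mulA (R : realType) : associative (@quat_mul R).
Proof. by case=> ? ? ? ? [? ? ? ?] [? ? ? ?]; apply: quat_eq => /=; ring. Qed.

Lemma quat_mul1l (R : realType) : left_id (quat_real 1) (@quat_mul R).
Proof. by case=> ? ? ? ?; apply: quat_eq => /=; ring. Qed.

Lemma quat_mul1r (R : realType) : right_id (quat_real 1) (@quat_mul R).
Proof. by case=> ? ? ? ?; apply: quat_eq => /=; ring. Qed.

Lemma quat_mulDl (R : realType) : left_distributive (@quat_mul R) +%R.
Proof. by case=> ? ? ? ? [? ? ? ?] [? ? ? ?]; apply: quat_eq => /=; ring. Qed.

Lemma quat_mulDr (R : realType) : right_distributive (@quat_mul R) +%R.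
Proof. by case=> ? ? ? ? [? ? ? ?] [? ? ? ?]; apply: quat_eq => /=; ring. Qed.

Lemma quat_1neq0 (R : realType) : quat_real 1 != 0 :> quat R.
Proof. by apply/eqP => /(congr1 (@quat0 R)) /eqP; rewrite oner_eq0. Qed.

HB.instance Definition _ (R : realType) :=
  GRing.Zmodule_isNzRing.Build (quat R)
    (@quat_mulA R) (@quat_mul1l R) (@quat_mul1r R)
    (@quat_mulDl R) (@quat_mulDr R) (quat_1neq0 R).

Definition quat_sqn (R : realType) (x : quat R) : R :=
  quat0 x ^+ 2 + quat1 x ^+ 2 + quat2 x ^+ 2 + quat3 x ^+ 2.

Lemma quat_sqn_ge0 (R : realType) (x : quat R) : 0 <= quat_sqn x.
Proof. by rewrite !addr_ge0 ?sqr_ge0. Qed.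

Lemma quat_sqn_eq0 (R : realType) (x : quat R) : quat_sqn x = 0 -> x = 0.
Proof.
move/eqP; rewrite /quat_sqn !paddr_eq0 ?addr_ge0 ?sqr_ge0 // !sqrf_eq0.
by case/andP=> /andP[/andP[/eqP ? /eqP ?] /eqP ?] /eqP ?; apply: quat_eq.
Qed.

Lemma quat_sqnM (R : realType) (x y : quat R) :
  quat_sqn (x * y) = quat_sqn x * quat_sqn y.
Proof. by case: x y => [? ? ? ?] [? ? ? ?]; rewrite /quat_sqn /=; ring. Qed.

Definition quat_inv (R : realType) (x : quat R) : quat R :=
  Quat (quat0 x / quat_sqn x) (- quat1 x / quat_sqn x)
       (- quat2 x / quat_sqn x) (- quat3 x / quat_sqn x).

Lemma quat_mulVx (R : realType) :
  {in [pred x : quat R | x != 0], left_inverse 1 (@quat_inv R) *%R}.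
Proof.
move=> x; rewrite inE => x0.
have s0 : quat_sqn x != 0 by apply: contra_neq x0; apply: quat_sqn_eq0.
case: x {x0} s0 => a b c d s0.
by apply: quat_eq; rewrite /= /quat_sqn /= in s0 *; field.
Qed.

Lemma quat_mulxV (R : realType) :
  {in [pred x : quat R | x != 0], right_inverse 1 (@quat_inv R) *%R}.
Proof.
move=> x; rewrite inE => x0.
have s0 : quat_sqn x != 0 by apply: contra_neq x0; apply: quat_sqn_eq0.
case: x {x0} s0 => a b c d s0.
by apply: quat_eq; rewrite /= /quat_sqn /= in s0 *; field.
Qed.

Lemma quat_unitP (R : realType) (x y : quat R) :
  y * x = 1 /\ x * y = 1 -> x \in [pred x : quat R | x != 0].
Proof.
by case=> yx _; rewrite inE; apply: contra_eq_neq yx => ->;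
  rewrite mulr0 eq_sym oner_neq0.
Qed.

Lemma quat_inv_out (R : realType) :
  {in [predC [pred x : quat R | x != 0]], @quat_inv R =1 id}.
Proof.
move=> x; rewrite !inE negbK => /eqP ->.
by apply: quat_eq; rewrite /= ?oppr0 mul0r.
Qed.

HB.instance Definition _ (R : realType) :=
  GRing.NzRing_hasMulInverse.Build (quat R)
    (@quat_mulVx R) (@quat_mulxV R) (@quat_unitP R) (@quat_inv_out R).

Definition quat_norm (R : realType) (x : quat R) : R := Num.sqrt (quat_sqn x).

Lemma quat_normD (R : realType) (x y : quat R) :
  quat_norm (x + y) <= quat_norm x + quat_norm y.
Proof.
have s0 (z : quat R) : 0 <= quat_norm z := sqrtr_ge0 _.
have sE (z : quat R) : quat_norm z ^+ 2 = quat_sqn z.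
  by rewrite sqr_sqrtr ?quat_sqn_ge0.
rewrite -ler_sqr ?nnegrE ?addr_ge0 // sqrrD !sE.
pose p := quat0 x * quat0 y + quat1 x * quat1 y
        + quat2 x * quat2 y + quat3 x * quat3 y.
have -> : quat_sqn (x + y) = quat_sqn x + p *+ 2 + quat_sqn y.
  by rewrite /quat_sqn /p /=; ring.
rewrite lerD2r lerD2l lerMn2r /=.
apply: le_trans (ler_norm _) _.
rewrite -ler_sqr ?nnegrE ?normr_ge0 ?mulr_ge0 // exprMn !sE real_normK ?num_real //.
rewrite -subr_ge0 /p /quat_sqn.
case: x y {p} => [a b c d] [a' b' c' d'] /=.
rewrite [leRHS](_ : _ = (a * b' - b * a') ^+ 2 + (a * c' - c * a') ^+ 2
  + (a * d' - d * a') ^+ 2 + (b * c' - c * b') ^+ 2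
  + (b * d' - d * b') ^+ 2 + (c * d' - d * c') ^+ 2); last by ring.
by rewrite !addr_ge0 ?sqr_ge0.
Qed.

Lemma quat_norm_eq0 (R : realType) (x : quat R) : quat_norm x = 0 -> x = 0.
Proof.
move/eqP; rewrite sqrtr_eq0 => s0.
by apply/quat_sqn_eq0/eqP; rewrite eq_le s0 quat_sqn_ge0.
Qed.

Lemma quat_sqnMn (R : realType) (x : quat R) (m : nat) :
  quat_sqn (x *+ m) = quat_sqn x * m%:R ^+ 2.
Proof.
have -> : x *+ m = quat_real m%:R * x.
  elim: m => [|m IHm]; first by rewrite mulr0n [quat_real _](_ : _ = 0) ?mul0r.
  rewrite mulrS IHm -{1}[x]mul1r -mulrDl; congr (_ * _).
  by apply: quat_eq; rewrite /= ?addr0 // mulrS.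
by rewrite quat_sqnM mulrC /quat_sqn /=; ring.
Qed.

Lemma quat_normMn (R : realType) (x : quat R) (m : nat) :
  quat_norm (x *+ m) = quat_norm x *+ m.
Proof.
by rewrite /quat_norm quat_sqnMn sqrtrM ?quat_sqn_ge0 // sqrtr_sqr
  ger0_norm ?ler0n // mulr_natr.
Qed.

Lemma quat_normN (R : realType) (x : quat R) : quat_norm (- x) = quat_norm x.
Proof. by rewrite /quat_norm /quat_sqn /= !sqrrN. Qed.

HB.instance Definition _ (R : realType) :=
  Num.Zmodule_isNormed.Build R (quat R)
    (@quat_normD R) (@quat_norm_eq0 R) (@quat_normMn R) (@quat_normN R).

Lemma quat_normE (R : realType) (x : quat R) :
  `|x| = Num.sqrt (quat0 x ^+ 2 + quat1 x ^+ 2 + quat2 x ^+ 2 + quat3 x ^+ 2).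
Proof. by []. Qed.

Lemma quat_normM (R : realType) (x y : quat R) : `|x * y| = `|x| * `|y|.
Proof. by rewrite !quat_normE -sqrtrM ?quat_sqn_ge0 // -quat_sqnM. Qed.

Lemma quat_norm_real (R : realType) (a : R) : `|quat_real a| = `|a|.
Proof. by rewrite quat_normE /= !expr0n /= !addr0 sqrtr_sqr. Qed.

Definition is_quat_real (R : realType) (x : quat R) : Prop :=
  exists a : R, x = quat_real a.

Definition right_eigenvalue (R : realType) (n : nat) (A : 'M[quat R]_n)
    (lam : quat R) : Prop :=
  exists2 x : 'cV[quat R]_n, x != 0 & A *m x = map_mx (fun q => q * lam) x.

Definition right_spectrum (R : realType) (n : nat) (A : 'M[quat R]_n) :
    set (quat R) :=
  [set lam | right_eigenvalue A lam].

Definition row_radius (R : realType) (n : nat) (A : 'M[quat R]_n) (i : 'I_n) : R :=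
  \sum_(j < n | j != i) `|A i j|.

Definition col_radius (R : realType) (n : nat) (A : 'M[quat R]_n) (i : 'I_n) : R :=
  \sum_(j < n | j != i) `|A j i|.

(* [powR] satisfies 0 `^ 0 = 1 and 0 `^ a = 0 for a != 0. *)
Definition cassini_oval (R : realType) (n : nat) (A : 'M[quat R]_n) (gam : R)
    (i j : 'I_n) : set (quat R) :=
  [set z | `|z - A i i| * `|z - A j j| <=
    row_radius A i `^ gam * row_radius A j `^ gam *
    col_radius A i `^ (1 - gam) * col_radius A j `^ (1 - gam)].

Definition cassini_region (R : realType) (n : nat) (A : 'M[quat R]_n) (gam : R) :
    set (quat R) :=
  \bigcup_(p in [set p : 'I_n * 'I_n | p.1 != p.2]) cassini_oval A gam p.1 p.2.

(* Hence the ordered pairs i != j give only n(n-1)/2 ovals. *)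
Lemma cassini_ovalC (R : realType) (n : nat) (A : 'M[quat R]_n) (gam : R)
    (i j : 'I_n) : cassini_oval A gam i j = cassini_oval A gam j i.
Proof.
rewrite /cassini_oval [row_radius A i `^ gam * _]mulrC -!mulrA.
rewrite [col_radius A i `^ _ * _]mulrC.
by apply/seteqP; split=> z /=; rewrite [`|z - A i i| * _]mulrC.
Qed.

(* Main.v *)
Require Import Defs.
From mathcomp Require Import all_boot all_order all_algebra.
From mathcomp Require Import all_classical all_reals all_analysis.

Import Order.TTheory GRing.Theory Num.Theory.

Local Open Scope classical_set_scope.
Local Open Scope ring_scope.

(** Because the diagonal entries are real, they commute with the entries of
    an eigenvector [x], so row [i] of [A x = x lam] says that
    [x_i (lam - a_ii)] is the sum of the [a_ij x_j] with [j != i].  Taking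
    norms leaves a statement on nonnegative reals: with [u_i = |x_i|],
    [d_i = |lam - a_ii|] and [b_ij = |a_ij|],

      [d_i u_i <= \sum_(j != i) b_ij u_j]  for all [i],

    and two distinct indices with
    [d_i d_j <= (r_i r_j)^gam (c_i c_j)^(1 - gam)] are wanted
    ([ostrowski_brauer]).

    For [gam = 1] it suffices to compare rows [k] and [l], where [u_k] and
    [u_l] are the two largest entries of [u] ([row_cassini]).  For [gam = 0]
    the rows are added up with weights, which makes the column sums appear;
    one row needs a weight of its own, since one of the [d_i] may be smaller
    than [c_i] ([column_cassini]).  For the other exponents, write
    [s = 1 - gam] and [u_j = v_j^s].  Hölder's inequality gives
    [\sum_j b_ij v_j^s <= r_i^gam (\sum_j b_ij v_j)^s]
    ([holder_sum_powR]), and raising to the power [1 / s] turns the system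
    above into the same kind of system for [v], with [d_i] replaced by
    [(d_i / r_i^gam)^(1 / s)]; the column case applies to it. *)

(** * Powers and sums *)

Lemma powR_le_tangent (R : realType) (x s : R) :
  0 <= x -> 0 < s < 1 -> x `^ s <= 1 - s + s * x.
Proof.
move=> x0 /andP[s0 s1].
have s1' : 0 < 1 - s by rewrite subr_gt0.
have := @conjugate_powR R 1 (x `^ s) (1 - s)^-1 s^-1 ler01 (powR_ge0 _ _).
rewrite !invr_gt0 !invrK subrK => /(_ s1' s0 erefl).
by rewrite powR1 !mul1r -powRrM divff ?gt_eqF// powRr1// [x * _]mulrC.
Qed.

(** Once [w] is divided by its mean with respect to the weights [b], this is
    the sum of the tangent line bounds of [t |-> t^s] at [1]. *)
Lemma holder_sum_powR (R : realType) (T : finType) (P : pred T)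
    (b w : T -> R) (s : R) :
  0 < s <= 1 -> (forall j, 0 <= b j) -> (forall j, 0 <= w j) ->
  \sum_(j | P j) b j * w j `^ s <=
    (\sum_(j | P j) b j) `^ (1 - s) * (\sum_(j | P j) b j * w j) `^ s.
Proof.
move=> /andP[s0 s1] b0 w0.
have bw0 j : 0 <= b j * w j by rewrite mulr_ge0.
set B := \sum_(j | P j) b j; set W := \sum_(j | P j) b j * w j.
have B0 : 0 <= B by exact: sumr_ge0.
have W0 : 0 <= W by exact: sumr_ge0.
move: s1; rewrite le_eqVlt => /predU1P[->|s1].
  rewrite subrr powRr0 mul1r powRr1//.
  by under eq_bigr => j _ do rewrite powRr1//.
(* The mean vanishes only if every term does. *)
have [W_eq0|W_neq0] := eqVneq W 0.
  rewrite big1 ?mulr_ge0 ?powR_ge0// => j Pj.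
  have /eqP := psumr_eq0P (fun j _ => bw0 j) W_eq0 Pj.
  by rewrite mulf_eq0 => /orP[]/eqP ->; rewrite ?mul0r// powR0 ?mulr0 ?gt_eqF.
have Wpos : 0 < W by rewrite lt0r W_neq0.
have Bpos : 0 < B.
  rewrite lt0r B0 andbT; apply: contra W_neq0 => /eqP B_eq0.
  apply/eqP/big1 => j Pj.
  by rewrite (psumr_eq0P (fun j _ => b0 j) B_eq0 Pj) mul0r.
pose m := W / B.
have m0 : 0 < m by rewrite divr_gt0.
have -> : B `^ (1 - s) * W `^ s = B * m `^ s.
  have WE : W = B * m by rewrite /m mulrCA divff ?mulr1 ?gt_eqF.
  rewrite [in LHS]WE.
  rewrite powRM ?(ltW m0)// mulrA -powRD ?subrK ?powRr1//.
  by rewrite oner_eq0.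
have term j : P j -> b j * w j `^ s <=
    (b j * (1 - s) + s / m * (b j * w j)) * m `^ s.
  move=> _.
  rewrite -{1}[w j](divfK (lt0r_neq0 m0)) powRM ?divr_ge0 ?(ltW m0)// mulrA.
  rewrite ler_wpM2r ?powR_ge0//.
  have /(ler_wpM2l (b0 j)) : (w j / m) `^ s <= 1 - s + s * (w j / m).
    by apply: powR_le_tangent; rewrite ?divr_ge0 ?(ltW m0)// s0 s1.
  by rewrite mulrDr; congr (_ <= _ + _); rewrite mulrCA -!mulrA; congr (_ * _);
     rewrite [RHS]mulrC mulrA.
apply: (le_trans (ler_sum _ term)).
rewrite -mulr_suml big_split/= -mulr_suml -mulr_sumr -/B -/W.
rewrite ler_wpM2r ?powR_ge0// [X in _ + X](_ : _ = B * s).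
  by rewrite -mulrDr subrK mulr1.
by rewrite /m invf_div mulrA mulfVK// mulrC.
Qed.

(** * Cassini inequalities for nonnegative systems *)

(** The two largest entries of [u] bound each other's rows. *)
Lemma row_cassini (R : realFieldType) (T : finType) (b : T -> T -> R)
    (u d : T -> R) :
  (1 < #|T|)%N -> (forall i j, 0 <= b i j) -> (forall i, 0 <= u i) ->
  (exists i, 0 < u i) -> (forall i, 0 < d i) ->
  (forall i, d i * u i <= \sum_(j | j != i) b i j * u j) ->
  exists i j, i != j /\
    d i * d j <= (\sum_(h | h != i) b i h) * (\sum_(h | h != j) b j h).
Proof.
move=> T2 b0 u0 [i0 ui0] d0 du.
have [k _ kmax] := @arg_maxP _ _ T i0 xpredT u isT.
have uk : 0 < u k by apply: lt_le_trans (kmax i0 isT).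
have [l0 l0k] : exists l, l != k.
  by have /card_gt1P[x [y [_ _ xy]]] := T2;
     have [xk|xk] := eqVneq x k; [exists y; rewrite -xk eq_sym | exists x].
have [l lk lmax] := @arg_maxP _ _ T l0 (fun l => l != k) u l0k.
have bound i m : (forall j, j != i -> u j <= u m) ->
    d i * u i <= (\sum_(h | h != i) b i h) * u m.
  move=> um; apply: le_trans (du i) _; rewrite mulr_suml.
  by apply: ler_sum => j ji; rewrite ler_wpM2l// um.
have dk := bound k l lmax.
have dl := bound l k (fun j _ => kmax j isT).
have ul : 0 < u l.
  rewrite lt0r u0 andbT; apply/eqP => ul0.
  by move: dk; rewrite ul0 mulr0 leNgt mulr_gt0.
exists k, l; split; first by rewrite eq_sym.
rewrite -(ler_pM2r (mulr_gt0 uk ul)) mulrACA.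
rewrite [u k * u l in leRHS]mulrC [leRHS]mulrACA.
by apply: ler_pM; rewrite ?mulr_ge0 ?(ltW (d0 _)).
Qed.

(** Suppose that all the wanted inequalities fail, and let [k] maximise [c_i
    / e_i] among the [i] with [v_i > 0]. Row [k] is given the weight [t =
    c_k / e_k] and the other rows the weight [1]. In the weighted sum of the
    rows, the coefficients of [v_k] on the two sides are then both equal to
    [c_k]; for [j != k] with [v_j > 0] the left one is [e_j], and the right
    one is at most [max(1, t) c_j], which is smaller: if [t < 1] because
    [c_j / e_j <= t], and otherwise because [c_k c_j < e_k e_j]. So the sum
    contradicts itself as soon as [v] has a positive entry besides [v_k],
    and row [k] provides one. *)
Lemma column_cassini (R : realFieldType) (T : finType) (b : T -> T -> R)
    (v e : T -> R) :
  (forall i j, 0 <= b i j) -> (forall i, 0 <= v i) ->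
  (exists i, 0 < v i) -> (forall i, 0 < v i -> 0 < e i) ->
  (forall i, e i * v i <= \sum_(j | j != i) b i j * v j) ->
  exists i j, [/\ i != j, 0 < v i, 0 < v j &
    e i * e j <= (\sum_(h | h != i) b h i) * (\sum_(h | h != j) b h j)].
Proof.
move=> b0 v0 [i0 vi0] e0 ev.
pose c j := \sum_(h | h != j) b h j.
have c0 j : 0 <= c j by exact: sumr_ge0.
have [k vk kmax] := @arg_maxP _ _ T i0 (fun i => 0 < v i) (fun i => c i / e i) vi0.
have ek := e0 k vk.
have [l lk vl] : exists2 l, l != k & 0 < v l.
  apply: contrapT => nl.
  have := ev k; rewrite big1 ?leNgt ?mulr_gt0// => j jk.
  have [->|vj] := eqVneq (v j) 0; first by rewrite mulr0.
  by case: nl; exists j => //; rewrite lt0r vj v0.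
apply: contrapT => nex.
have ltc j : j != k -> 0 < v j -> c k * c j < e k * e j.
  move=> jk vj; rewrite ltNge; apply/negP => le_ec; apply: nex.
  by exists k, j; split => //; rewrite eq_sym.
pose t := c k / e k.
have t0 : 0 <= t by rewrite divr_ge0// ltW.
pose s i := if i == k then t else 1.
have s0 i : 0 <= s i by rewrite /s; case: ifP.
pose D j := if j == k then c k else Num.max 1 t * c j.
have colD j : \sum_(i | i != j) s i * b i j <= D j.
  rewrite /D; have [->|jk] := eqVneq j k.
    by apply: ler_sum => i ik; rewrite /s (negbTE ik) mul1r.
  rewrite mulr_sumr; apply: ler_sum => i _; rewrite ler_wpM2r// /s.
  by case: ifP; rewrite le_max lexx ?orbT.
have ltD j : j != k -> 0 < v j -> D j < e j.
  move=> jk vj; have ej := e0 j vj; rewrite /D (negbTE jk).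
  have [t1|t1] := ltP t 1.
    by rewrite mul1r -[ltRHS]mul1r -ltr_pdivrMr//
       (le_lt_trans (kmax j vj)).
  by rewrite /t mulrAC ltr_pdivrMr// [ltRHS]mulrC ltc.
have leD j : D j * v j <= s j * e j * v j.
  have [->|vj] := eqVneq (v j) 0; first by rewrite !mulr0.
  have {}vj : 0 < v j by rewrite lt0r vj v0.
  rewrite ler_wpM2r//; have [->|jk] := eqVneq j k.
    by rewrite /D /s eqxx /t divfK// gt_eqF.
  by rewrite {1}/s (negbTE jk) mul1r ltW// ltD.
have : \sum_j s j * e j * v j <= \sum_j D j * v j.
  apply: (@le_trans _ _ (\sum_i \sum_(j | j != i) s i * b i j * v j)).
    apply: ler_sum => i _; rewrite -mulrA.
    under eq_bigr => j _ do rewrite -mulrA.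
    by rewrite -mulr_sumr ler_wpM2l.
  rewrite (exchange_big_dep xpredT)//=; apply: ler_sum => j _.
  rewrite -mulr_suml ler_wpM2r//; apply: le_trans (colD j).
  by rewrite (eq_bigl (fun i => i != j))// => i; rewrite eq_sym.
rewrite leNgt => /negP; apply.
rewrite (bigD1 l)//= [ltRHS](bigD1 l)//= ltr_leD//; last exact: ler_sum.
by rewrite {1}/s (negbTE lk) mul1r ltr_pM2r// ltD.
Qed.

Lemma ostrowski_brauer (R : realType) (T : finType) (b : T -> T -> R)
    (u d : T -> R) (gam : R) :
  0 <= gam <= 1 ->
  (1 < #|T|)%N -> (forall i j, 0 <= b i j) -> (forall i, 0 <= u i) ->
  (exists i, 0 < u i) -> (forall i, 0 <= d i) ->
  (forall i, d i * u i <= \sum_(j | j != i) b i j * u j) ->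
  let r i := \sum_(h | h != i) b i h in
  let c i := \sum_(h | h != i) b h i in
  exists i j, i != j /\
    d i * d j <= r i `^ gam * r j `^ gam * c i `^ (1 - gam) * c j `^ (1 - gam).
Proof.
move=> /andP[gam0 gam1] T2 b0 u0 ex_u d0 du r c.
have r0 i : 0 <= r i by exact: sumr_ge0.
have c0 i : 0 <= c i by exact: sumr_ge0.
(* A vanishing [d i] settles the claim with any second index. *)
have [[i di]|dn0] := pselect (exists i, d i = 0).
  have [j ij] : exists j, i != j.
    by have /card_gt1P[x [y [_ _ xy]]] := T2;
       have [xi|xi] := eqVneq i x; [exists y; rewrite xi | exists x].
  by exists i, j; split=> //; rewrite di mul0r !mulr_ge0 ?powR_ge0.
have {dn0} dpos i : 0 < d i.
  by rewrite lt0r d0 andbT; apply/eqP => di; apply: dn0; exists i.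
move: gam1; rewrite le_eqVlt => /predU1P[->|gam1].
  have [i [j [ij dd]]] := row_cassini R T b u d T2 b0 u0 ex_u dpos du.
  by exists i, j; split=> //; rewrite subrr !powRr0 !mulr1 !powRr1.
set s := 1 - gam.
have spos : 0 < s by rewrite subr_gt0.
have sn0 : s != 0 by rewrite gt_eqF.
have s1 : s <= 1 by rewrite gerBl.
pose v i := u i `^ s^-1.
pose e i := (d i / r i `^ gam) `^ s^-1.
have vK i : v i `^ s = u i by rewrite /v -powRrM mulVf// powRr1.
have v_gt0 i : 0 < v i -> 0 < u i.
  by apply: gt0_powR => //; rewrite invr_gt0.
(* On the support of [u] the rows do not vanish, so that dividing by
   [r i `^ gam] is legitimate there. *)
have r_gt0 i : 0 < u i -> 0 < r i.
  move=> ui; rewrite lt0r r0 andbT; apply/eqP => ri0.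
  have := du i; rewrite big1 ?leNgt ?mulr_gt0// => j ji.
  by rewrite (psumr_eq0P (fun j _ => b0 i j) ri0 ji) mul0r.
have [||||i [j [ij vi vj ee]]] := column_cassini R T b v e b0.
- by move=> i; exact: powR_ge0.
- by have [i ui] := ex_u; exists i; exact: powR_gt0.
- by move=> i /v_gt0/r_gt0 ri; rewrite powR_gt0// divr_gt0// powR_gt0.
- move=> i.
  have W0 : 0 <= \sum_(j | j != i) b i j * v j.
    by apply: sumr_ge0 => j _; rewrite mulr_ge0// powR_ge0.
  have [ui|ui] := eqVneq (u i) 0.
    by rewrite /v ui powR0 ?mulr0 ?invr_eq0.
  have {}ui : 0 < u i by rewrite lt0r ui u0.
  have rg := powR_gt0 gam (r_gt0 i ui).
  rewrite -powRM ?divr_ge0 ?powR_ge0//.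
  rewrite -[leRHS]powRr1// -(divff sn0) powRrM.
  apply: ge0_ler_powR; rewrite ?nnegrE ?invr_ge0 ?(ltW spos) ?powR_ge0//.
    by rewrite mulr_ge0// divr_ge0// powR_ge0.
  rewrite mulrAC ler_pdivrMr// mulrC [leLHS]mulrC [leRHS]mulrC.
  apply: le_trans (du i) _.
  under eq_bigr => j _ do rewrite -vK.
  have -> : gam = 1 - s by rewrite /s opprB addrC subrK.
  by apply: holder_sum_powR; rewrite ?spos// => j; exact: powR_ge0.
exists i, j; split=> //.
have rgi := powR_gt0 gam (r_gt0 i (v_gt0 i vi)).
have rgj := powR_gt0 gam (r_gt0 j (v_gt0 j vj)).
have eK h : e h `^ s = d h / r h `^ gam.
  by rewrite /e -powRrM mulVf// powRr1// divr_ge0// powR_ge0.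
have : (e i * e j) `^ s <= (c i * c j) `^ s.
  by apply: ge0_ler_powR; rewrite ?nnegrE ?mulr_ge0 ?powR_ge0 ?(ltW spos).
rewrite !powRM ?powR_ge0// !eK mulf_div ler_pdivrMr ?mulr_gt0//.
by rewrite mulrC [leRHS]mulrC mulrA [d j * _]mulrC.
Qed.

(** * Right eigenvalues *)

Lemma quat_real_comm (R : realType) (a : R) (x : quat R) :
  quat_real a * x = x * quat_real a.
Proof.
by case: x => x0 x1 x2 x3; apply: quat_eq;
  rewrite /= !(mul0r, mulr0, subr0, addr0, add0r) ?sub0r ?oppr0 ?add0r mulrC.
Qed.

(** The reality of [A i i] lets it pass to the right of [x i 0], where it is
    subtracted from [lam]. *)
Lemma right_eigen_row_le (R : realType) (n : nat) (A : 'M[quat R]_n)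
    (x : 'cV[quat R]_n) (lam : quat R) (i : 'I_n) :
  is_quat_real (A i i) -> A *m x = map_mx (fun q => q * lam) x ->
  `|lam - A i i| * `|x i 0| <= \sum_(j | j != i) `|A i j| * `|x j 0|.
Proof.
move=> [a Aii] /matrixP/(_ i 0); rewrite !mxE (bigD1 i)//= => Ax.
rewrite mulrC -quat_normM mulrBr -Ax Aii quat_real_comm addrAC subrr add0r.
apply: le_trans (ler_norm_sum _ _ _) _.
by apply: ler_sum => j _; rewrite quat_normM.
Qed.

Theorem theorem3p11 (R : realType) (n : nat) (hn : (2 <= n)%N)
    (A : 'M[quat R]_n) (hA : forall i : 'I_n, is_quat_real (A i i))
    (gam : R) (hgam0 : 0 <= gam) (hgam1 : gam <= 1) :
  right_spectrum A `<=` cassini_region A gam.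
Proof.
move=> lam [x x0 Ax].
have [||||||i|i [j [ij dd]]] := @ostrowski_brauer R 'I_n
  (fun i j => `|A i j|) (fun i => `|x i 0|) (fun i => `|lam - A i i|) gam.
- by rewrite hgam0 hgam1.
- by rewrite card_ord.
- by move=> i j; exact: normr_ge0.
- by move=> i; exact: normr_ge0.
- have /cV0Pn[i xi] := x0.
  by exists i; rewrite normr_gt0.
- by move=> i; exact: normr_ge0.
- exact: right_eigen_row_le (hA i) Ax.
by exists (i, j).
Qed.
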